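(* Let $\mathcal{H}$ be an inner product space of dimension at least $2$. Let $n\ge 2$, let $a_1,\dots,a_n$ be fixed real numbers, and let $\mathcal{J}\subseteq\mathcal{P}(\overline{n})$ be a family of subsets of $\overline{n}$. For $I\subseteq\overline{n}$ put $a_I=\prod_{i\in I}a_i$. Then $$\sum_{I\in\mathcal{J}} a_I\sum_{J\subseteq I}\|x_J-x_{I\setminus J}\|^2=0$$ holds for all $x_1,\dots,x_n\in\mathcal{H}$ if and only if for each $i\in\overline{n}$, $$\sum_{I\in\mathcal{J},\ i\in I}2^{|I|}a_I=0.$$
   Context: $\overline{n}=\{1,2,\dots,n\}$ and $\mathcal{P}(\overline{n})$ is its power set. For $A\subseteq\overline{n}$, $x_A=\sum_{i\in A}x_i$ (so $x_\emptyset=0$), and $|A|$ is the cardinality of $A$. The empty product is $1$. The norm is the one induced by the inner product. *)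

(* Defs.v *)
From mathcomp Require Import all_boot all_order all_algebra.
From mathcomp Require Import reals complex.

Set Implicit Arguments.
Unset Strict Implicit.
Unset Printing Implicit Defensive.

Import GRing.Theory Num.Theory.
Local Open Scope ring_scope.

(* [V] may be infinite-dimensional, so "dimension at least [m]" is the
   existence of [m] linearly independent vectors. *)
Definition dim_at_least (F : fieldType) (V : lmodType F) (m : nat) : Prop :=
  exists e : 'I_m -> V, forall c : 'I_m -> F,
    \sum_(i < m) c i *: e i = 0 -> forall i, c i = 0.

Definition real_norm (R : realType) (H : lmodType R) (ip : {dot H for idfun})
    (v : H) : R :=
  Num.sqrt (ip v v).

(* [ip v v] is a nonnegative real element of [R[i]]; taking its real part makes
   the norm [R]-valued. *)
Definition complex_norm (R : realType) (H : lmodType R[i])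
    (ip : {dot H for Num.conj}) (v : H) : R :=
  Num.sqrt (complex.Re (ip v v)).

Definition subset_sum (V : zmodType) (n : nat) (x : 'I_n -> V)
    (A : {set 'I_n}) : V :=
  \sum_(i in A) x i.

Definition subset_prod (R : realType) (n : nat) (a : 'I_n -> R)
    (I : {set 'I_n}) : R :=
  \prod_(i in I) a i.

Definition weighted_sum (R : realType) (V : zmodType) (nrm : V -> R) (n : nat)
    (a : 'I_n -> R) (JJ : {set {set 'I_n}}) (x : 'I_n -> V) : R :=
  \sum_(I in JJ) subset_prod a I *
    \sum_(J : {set 'I_n} | J \subset I)
      nrm (subset_sum x J - subset_sum x (I :\: J)) ^+ 2.

(* Main.v *)
Require Import Defs.
From mathcomp Require Import all_boot all_order all_algebra.
From mathcomp Require Import reals complex.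

(** For every [I] the inner sum has a closed form:
      [sum_{J subset I} |x_J - x_{I\J}|^2 = 2^|I| sum_{i in I} |x_i|^2].
    Indeed the vectors [x_J - x_{I\J}] are the signed sums of the [x_i], and
    each pair of sign patterns that differ only at [i] contributes, by the
    parallelogram law, twice the value for the remaining indices plus
    [2 |x_i|^2]; so the closed form follows by adding the indices of [I] one at
    a time (lemma [sum_sqnorm_signed_sums]).

    Substituting it and exchanging the two sums, the weighted sum becomes the
    diagonal quadratic form [sum_i c_i |x_i|^2] with
    [c_i = sum_{I in JJ, i in I} 2^|I| a_I] (lemma [weighted_sumE]).  If all
    [c_i] vanish so does the form.  Conversely, the family whose only nonzero
    entry is a vector [v <> 0] at [i] gives [c_i |v|^2 = 0], hence [c_i = 0].

    The real and the complex case differ only in how the squared norm is read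
    off from the inner product, so the argument is carried out for an arbitrary
    real-valued function [nrm] whose square satisfies the parallelogram law. *)

Set Implicit Arguments.
Unset Strict Implicit.
Unset Printing Implicit Defensive.

Import Order.TTheory GRing.Theory Num.Theory.
Local Open Scope ring_scope.

(** A subset of [i |: I] is either a subset of [I] or [i] added to one. *)
Lemma big_subset_setU1 (V : nmodType) (T : finType) (i : T) (I : {set T})
    (F : {set T} -> V) : i \notin I ->
  \sum_(J : {set T} | J \subset i |: I) F J =
  \sum_(J : {set T} | J \subset I) (F (i |: J) + F J).
Proof.
move=> iI; rewrite big_split (bigID [pred J : {set T} | i \in J]) /=.
congr (_ + _); last first.
  apply: eq_bigl => J; rewrite -subDset.
  have [iJ|iJ] /= := boolP (i \in J).
    by rewrite andbF; apply/esym/negbTE; apply: contra iI => /subsetP; apply.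
  by rewrite andbT (setDidPl _) // disjoint_sym disjoints1.
rewrite (reindex_onto (fun J => i |: J) (fun J => J :\ i)) /=; last first.
  by move=> J /andP[_ iJ]; rewrite setD1K.
apply: eq_bigl => J; rewrite setU11 andbT.
apply/andP/idP => [[+ /eqP JE]|JI].
  by rewrite -{2}JE subDset.
have iJ : i \notin J by apply: contra iI; apply: (subsetP JI).
by rewrite setUS // setU1K.
Qed.

Definition parallelogram_law (V K : zmodType) (q : V -> K) : Prop :=
  forall u v, q (u + v) + q (u - v) = q u *+ 2 + q v *+ 2.

Section SignedSums.
Variables (K : numDomainType) (V : zmodType) (q : V -> K).
Hypothesis qP : parallelogram_law q.

Lemma parallelogram_law0 : q 0 = 0.
Proof.
have /eqP := qP 0 0; rewrite addr0 subr0 -mulr2n -subr_eq0 opprD addrA subrr.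
by rewrite add0r oppr_eq0 mulrn_eq0 => /eqP.
Qed.

(** Induction on [#|I|]: removing [i] from the index set pairs the signed sums
    that differ only in the sign of [x i], and the parallelogram law evaluates
    each pair. *)
Lemma sum_sqnorm_signed_sums (n : nat) (x : 'I_n -> V) (I : {set 'I_n}) :
  \sum_(J : {set 'I_n} | J \subset I)
     q (subset_sum x J - subset_sum x (I :\: J)) =
  2 ^+ #|I| * \sum_(i in I) q (x i).
Proof.
have [m] := ubnP #|I|; elim: m I => // m IH I Im.
have [->|[i iI]] := set_0Vmem I.
  rewrite cards0 big_set0 mulr0 (big_pred1 set0) => [|J]; last exact: subset0.
  by rewrite set0D subrr parallelogram_law0.
rewrite -(setD1K iI) in Im *.
have iI' : i \notin I :\ i by rewrite setD11.
move: (I :\ i) iI' Im => {iI}I iI Im.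
rewrite cardsU1 iI ltnS in Im *.
rewrite (big_subset_setU1 _ iI) big_setU1 //=.
(* For [d := x_J - x_{I\J}] the two terms are [q (d + x_i)] and [q (d - x_i)],
   so this is the parallelogram law at [d] and [x_i]. *)
have step (J : {set 'I_n}) : J \subset I ->
    q (subset_sum x (i |: J) - subset_sum x ((i |: I) :\: (i |: J))) +
    q (subset_sum x J - subset_sum x ((i |: I) :\: J)) =
    q (x i) *+ 2 + q (subset_sum x J - subset_sum x (I :\: J)) *+ 2.
  move=> JI; have iJ : i \notin J by apply: contra iI; apply: (subsetP JI).
  have -> : (i |: I) :\: (i |: J) = I :\: J.
    by apply/setP=> k; rewrite !inE; case: eqP => // ->; rewrite (negbTE iI) andbF.
  have -> : (i |: I) :\: J = i |: (I :\: J).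
    by apply/setP=> k; rewrite !inE; case: eqP => // ->; rewrite iJ.
  rewrite /subset_sum !big_setU1 ?inE ?(negbTE iI) ?andbF //=.
  rewrite [RHS]addrC -qP; congr (q _ + q _); first by rewrite -addrA addrC.
  by rewrite opprD [- x i - _]addrC addrA.
rewrite (eq_bigr _ step) big_split /= sumr_const !sumrMnl IH //.
have -> : #|[pred J : {set 'I_n} | J \subset I]| = (2 ^ #|I|)%N.
  by rewrite -card_powerset; apply: eq_card => J; rewrite !inE.
rewrite exprS -mulrA mulr_natl mulrDr [RHS]mulrnDl; congr (_ + _).
by rewrite mulrnAC -[_ *+ 2 ^ _]mulr_natl natrX.
Qed.

End SignedSums.

Lemma weighted_sumE (R : realType) (V : zmodType) (nrm : V -> R) (n : nat)
    (a : 'I_n -> R) (JJ : {set {set 'I_n}}) (x : 'I_n -> V) :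
  parallelogram_law (fun v => nrm v ^+ 2) ->
  weighted_sum nrm a JJ x =
  \sum_(i < n) (\sum_(I in JJ | i \in I) 2 ^+ #|I| * subset_prod a I) *
     nrm (x i) ^+ 2.
Proof.
move=> nrmP; under [RHS]eq_bigr do rewrite mulr_suml.
rewrite /weighted_sum (exchange_big_dep [in JJ]) => [|i I _ /andP[]] //=.
apply: eq_bigr => I IJJ; rewrite (sum_sqnorm_signed_sums nrmP).
rewrite mulrCA mulrA mulr_sumr; apply: eq_bigl => i.
by rewrite IJJ.
Qed.

(** A single vector of nonzero norm suffices to read off the coefficients of
    the diagonal form, by placing it at one index at a time. *)
Lemma weighted_sum_eq0P (R : realType) (V : zmodType) (nrm : V -> R) (n : nat)
    (a : 'I_n -> R) (JJ : {set {set 'I_n}}) :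
  parallelogram_law (fun v => nrm v ^+ 2) -> (exists v, nrm v != 0) ->
  (forall x : 'I_n -> V, weighted_sum nrm a JJ x = 0) <->
  (forall i : 'I_n,
     \sum_(I in JJ | i \in I) 2 ^+ #|I| * subset_prod a I = 0).
Proof.
move=> nrmP [v v_neq0]; split => [sum0 i|coef0 x]; last first.
  by rewrite weighted_sumE // big1 // => i _; rewrite coef0 mul0r.
have := sum0 (fun k => if k == i then v else 0).
rewrite weighted_sumE // (bigD1 i) //= eqxx [X in _ + X]big1 => [|k ki]; last first.
  by rewrite (negbTE ki) (parallelogram_law0 nrmP) mulr0.
by move/eqP; rewrite addr0 mulf_eq0 expf_eq0 (negbTE v_neq0) orbF => /eqP.
Qed.

Section DotProduct.
Variables (K : numDomainType) (H : lmodType K) (theta : K -> K).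
Variable ip : {dot H for theta}.

(** The cross terms [ip u v] and [ip v u] cancel separately, so symmetric and
    Hermitian products are covered by one computation. *)
Lemma dot_parallelogram_law : parallelogram_law (fun v => ip v v).
Proof.
move=> u v; rewrite linearDl linearBl !linearDr !linearNr opprD opprK.
by rewrite addrACA; congr (_ + _); rewrite addrACA subrr ?addr0 ?add0r.
Qed.

Lemma dot_ge0 (v : H) : 0 <= ip v v.
Proof.
by have [->|/neq0_dnorm_gt0 /ltW //] := eqVneq v 0; rewrite linear0r.
Qed.

End DotProduct.

Lemma dim_at_least_neq0 (F : fieldType) (V : lmodType F) (m : nat) :
  dim_at_least V m.+1 -> exists v : V, v != 0.
Proof.
move=> [e e_free]; exists (e ord0); apply/eqP => e0.
have relation : \sum_(i < m.+1) (i == ord0)%:R *: e i = 0.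
  rewrite (bigD1 ord0) //= e0 scaler0 big1 ?addr0 // => i i_neq0.
  by rewrite (negbTE i_neq0) scale0r.
by have /eqP := e_free _ relation ord0; rewrite eqxx oner_eq0.
Qed.

Theorem theorem3p4 (R : realType) (n : nat) (hn : (2 <= n)%N) (a : 'I_n -> R)
    (JJ : {set {set 'I_n}}) :
  (forall (H : lmodType R) (ip : {dot H for idfun}),
     dim_at_least H 2 ->
     ((forall x : 'I_n -> H, weighted_sum (real_norm ip) a JJ x = 0) <->
      (forall i : 'I_n,
         \sum_(I in JJ | i \in I) 2 ^+ #|I| * subset_prod a I = 0))) /\
  (forall (H : lmodType R[i]) (ip : {dot H for Num.conj}),
     dim_at_least H 2 ->
     ((forall x : 'I_n -> H, weighted_sum (complex_norm ip) a JJ x = 0) <->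
      (forall i : 'I_n,
         \sum_(I in JJ | i \in I) 2 ^+ #|I| * subset_prod a I = 0))).
Proof.
split=> H ip /dim_at_least_neq0 [v v_neq0]; apply: weighted_sum_eq0P.
- by move=> u w; rewrite !sqr_sqrtr ?dot_ge0 // dot_parallelogram_law.
- by exists v; rewrite gt_eqF // sqrtr_gt0 neq0_dnorm_gt0.
- have Re_ge0 (u : H) : 0 <= complex.Re (ip u u).
    by have := dot_ge0 ip u; rewrite lecE => /andP[].
  move=> u w; rewrite !sqr_sqrtr //.
  (* Taking real parts is additive, hence preserves the parallelogram law. *)
  by have /(congr1 (@complex.Re R)) := dot_parallelogram_law ip u w;
     rewrite !raddfD.
- exists v; rewrite gt_eqF // sqrtr_gt0.
  by have := @neq0_dnorm_gt0 _ _ _ ip v v_neq0; rewrite ltcE => /andP[].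
Qed.
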